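(* Let $p$ be a prime, $n=rk$, $k>1$. Let $f:\mathbb{F}_{p^n}\to\mathbb{F}_{p^k}$, $h:\mathbb{F}_{p^k}\to\mathbb{F}_{p^k}$, $\gamma\in\mathbb{F}_{p^n}^*$ and $b\in\mathbb{F}_{p^k}^*$ be such that $\gamma$ is a $b$-linear translator of $f$. Let $L$ be an $\mathbb{F}_{p^k}$-linear permutation on $\mathbb{F}_{p^n}$. If $h$ is $b$-complete then $F(x)=L(x)+L(\gamma)h(f(x))$ permutes $\mathbb{F}_{p^n}$.
   Context: $\gamma$ is a $b$-linear translator of $f$ if $f(x+u\gamma)-f(x)=ub$ for all $x\in\mathbb{F}_{p^n}$ and all $u\in\mathbb{F}_{p^k}$. A function $h:\mathbb{F}_{p^k}\to\mathbb{F}_{p^k}$ is $b$-complete if both $h$ and $u\mapsto u+bh(u)$ permute $\mathbb{F}_{p^k}$. *)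

(* Defs.v *)
From HB Require Import structures.
From mathcomp Require Import all_boot all_order all_fingroup all_algebra all_field.

Set Implicit Arguments.
Unset Strict Implicit.
Unset Printing Implicit Defensive.

Import GRing.Theory.
Local Open Scope ring_scope.

(* The inclusion of F_{p^k} in F_{p^n} is the extension structure of E over K,
   so the product of u in K and g in E is the scaling u *: g. *)
Definition linear_translator (K : finFieldType) (E : fieldExtType K)
    (f : E -> K) (b : K) (g : E) : Prop :=
  forall (x : E) (u : K), f (x + u *: g) - f x = u * b.

Definition complete (K : finFieldType) (b : K) (h : K -> K) : Prop :=
  bijective h /\ bijective (fun u : K => u + b * h u).

(* Main.v *)
(* Write q for the inverse of u |-> u + b * h u. The map
   G x = x + h (f x) *: g shifts f by b * h (f x), so f x = q (f (G x)); hence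
   y |-> y - h (q (f y)) *: g inverts G, and F = L \o G. *)

Require Import Defs.
From HB Require Import structures.
From mathcomp Require Import all_boot all_order all_fingroup all_algebra all_field.

Set Implicit Arguments.
Unset Strict Implicit.
Unset Printing Implicit Defensive.

Import GRing.Theory.
Local Open Scope ring_scope.

(** By linearity [L] factors out, leaving the shift of [x] by [h (f x) *: gamma]. This shift acts on
    the value [u = f x] as [u + b * h u], so [f x], and then [x], can be recovered from the image:
    [bij_translator_shift]. *)

Lemma linear_translatorD (K : finFieldType) (E : fieldExtType K)
    (f : E -> K) (b : K) (g : E) (x : E) (u : K) :
  linear_translator f b g -> f (x + u *: g) = f x + b * u.
Proof. by move=> ft; rewrite [b * u]mulrC -(ft x u) [RHS]addrC subrK. Qed.

Lemma bij_translator_shift (K : finFieldType) (E : fieldExtType K)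
    (f : E -> K) (h : K -> K) (b : K) (g : E) :
  linear_translator f b g -> bijective (fun u => u + b * h u) ->
  bijective (fun x => x + h (f x) *: g).
Proof.
move=> ft [q qK Kq]; exists (fun y => y - h (q (f y)) *: g) => [x | y] /=.
  by rewrite (linear_translatorD _ _ ft) qK addrK.
(* The candidate preimage of [y] must have [f]-value [q (f y)]; this holds since [f y] is
   [q (f y) + b * h (q (f y))]. *)
have fE : f (y - h (q (f y)) *: g) = q (f y).
  by rewrite -scaleNr (linear_translatorD _ _ ft) mulrN -{1}(Kq (f y)) addrK.
by rewrite fE subrK.
Qed.

Theorem theorem5 (p n r k : nat) (hp : prime p) (hn : n = (r * k)%N)
    (hk : (1 < k)%N)
    (K : finFieldType) (hK : #|K| = (p ^ k)%N)
    (E : fieldExtType K) (hE : #|finvect_type E| = (p ^ n)%N)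
    (f : E -> K) (h : K -> K) (gamma : E) (b : K)
    (hgamma : gamma != 0) (hb : b != 0)
    (htrans : linear_translator f b gamma)
    (L : {linear E -> E}) (hL : bijective L)
    (hcompl : complete b h) :
  bijective (fun x : E => L x + h (f x) *: L gamma).
Proof.
have [_ hb_bij] := hcompl.
apply: (eq_bij (bij_comp hL (bij_translator_shift htrans hb_bij))) => x /=.
by rewrite linearD linearZ.
Qed.
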